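(* Let $G$ be a group, $R$ a commutative $G$-graded ring with nonzero unity, and $M$ a nonzero $G$-graded $R$-module. If $K$ is a graded maximal special $r$-submodule of $M$, then $K$ is a graded prime $R$-submodule of $M$.
   Context: A commutative ring $R$ is $G$-graded if $R=\bigoplus_{g\in G}R_g$ with additive subgroups $R_g$ satisfying $R_gR_h\subseteq R_{gh}$; an $R$-module $M$ is $G$-graded if $M=\bigoplus_{g\in G}M_g$ with additive subgroups $M_g$ satisfying $R_gM_h\subseteq M_{gh}$. Put $h(R)=\bigcup_{g\in G}R_g$ and $h(M)=\bigcup_{g\in G}M_g$. An $R$-submodule $K$ of $M$ is graded if $K=\bigoplus_{g\in G}(K\cap M_g)$. Notation: $(K:_R M)=\{r\in R: rM\subseteq K\}$; $Ann_R(x)=\{r\in R: rx=0\}$ for $x\in M$. A proper graded $R$-submodule $K$ of $M$ is graded prime if whenever $a\in h(R)$, $x\in h(M)$ and $ax\in K$, then $x\in K$ or $a\in (K:_R M)$. A proper graded $R$-submodule $K$ of $M$ is a graded special $r$-submodule if whenever $a\in h(R)$ and $x\in h(M)$ satisfy $ax\in K$ and $Ann_R(x)=\{0\}$, then $a\in(K:_R M)$. A graded maximal special $r$-submodule of $M$ is a graded special $r$-submodule of $M$ that is maximal with respect to inclusion among all graded special $r$-submodules of $M$. *)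

(* Defs.v *)
From mathcomp Require Import all_boot all_order all_algebra.
From mathcomp Require Import all_classical.

Set Implicit Arguments.
Unset Strict Implicit.
Unset Printing Implicit Defensive.

Import GRing.Theory.
Local Open Scope classical_set_scope.
Local Open Scope ring_scope.

(* The finiteness clause matters: a \sum_(g \in _) with infinite support is
   0 by convention. *)
Definition decomposition (V : zmodType) (G : choiceType) (A : G -> set V)
    (v : V) (f : G -> V) : Prop :=
  [/\ forall g, A g (f g), finite_set [set g | f g != 0]
    & v = \sum_(g \in [set: G]) f g].

(* S is the internal direct sum of the additive subgroups A g. *)
Definition is_direct_sum (V : zmodType) (G : choiceType) (S : set V)
    (A : G -> set V) : Prop :=
  [/\ forall g, zmod_closed [in A g],
      S = [set v | exists f, decomposition A v f]
    & forall v f f', decomposition A v f -> decomposition A v f' -> f =1 f'].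

Definition graded_ring (G : groupType) (R : comNzRingType)
    (Rg : G -> set R) : Prop :=
  is_direct_sum [set: R] Rg /\
  forall g h a b, Rg g a -> Rg h b -> Rg (g * h)%g (a * b).

Definition graded_module (G : groupType) (R : comNzRingType)
    (Rg : G -> set R) (M : lmodType R) (Mg : G -> set M) : Prop :=
  is_direct_sum [set: M] Mg /\
  forall g h a x, Rg g a -> Mg h x -> Mg (g * h)%g (a *: x).

Definition homogeneous (G V : Type) (A : G -> set V) : set V :=
  \bigcup_g A g.

Definition graded_submodule (G : groupType) (R : comNzRingType)
    (M : lmodType R) (Mg : G -> set M) (K : set M) : Prop :=
  submod_closed [in K] /\ is_direct_sum K (fun g => K `&` Mg g).

Definition colon (R : comNzRingType) (M : lmodType R) (K : set M) : set R :=
  [set r | forall m : M, K (r *: m)].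

Definition Ann (R : comNzRingType) (M : lmodType R) (x : M) : set R :=
  [set r | r *: x = 0].

Definition graded_prime (G : groupType) (R : comNzRingType)
    (Rg : G -> set R) (M : lmodType R) (Mg : G -> set M) (K : set M) : Prop :=
  [/\ graded_submodule Mg K, K <> [set: M]
    & forall a x, homogeneous Rg a -> homogeneous Mg x ->
        K (a *: x) -> K x \/ colon K a].

Definition graded_special_r (G : groupType) (R : comNzRingType)
    (Rg : G -> set R) (M : lmodType R) (Mg : G -> set M) (K : set M) : Prop :=
  [/\ graded_submodule Mg K, K <> [set: M]
    & forall a x, homogeneous Rg a -> homogeneous Mg x ->
        K (a *: x) -> Ann x = [set 0] -> colon K a].

Definition graded_maximal_special_r (G : groupType) (R : comNzRingType)
    (Rg : G -> set R) (M : lmodType R) (Mg : G -> set M) (K : set M) : Prop :=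
  graded_special_r Rg Mg K /\
  forall L : set M, graded_special_r Rg Mg L -> K `<=` L -> L = K.

(* Main.v *)
Require Import Defs.
From mathcomp Require Import finmap.
From mathcomp Require Import all_boot all_order all_algebra.
From mathcomp Require Import all_classical.

Set Implicit Arguments.
Unset Strict Implicit.
Unset Printing Implicit Defensive.

Import GRing.Theory.
Local Open Scope classical_set_scope.
Local Open Scope ring_scope.

(** Let [K] be a maximal graded special r-submodule and let [a] be homogeneous
    with [a M] not contained in [K].  The residual [(K :_M a) = {x | a x \in K}]
    contains [K], and it is again a graded special r-submodule:
    - it is proper, because [a M] is not contained in [K];
    - it is graded, because multiplication by [a] merely shifts degrees, so that
      the homogeneous components of [a x] are [a] times those of [x]
      ([decomposition_scale]);
    - it is special, because [a (b y) = (a b) y], with [a b] homogeneous: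
      if [b y] lies in the residual and [Ann y = 0], then specialness of [K]
      gives [a b M] inside [K], that is, [b M] inside the residual.
    Maximality forces [(K :_M a) = K], so [a x \in K] implies [x \in K]. *)

Definition residual (R : comNzRingType) (M : lmodType R) (K : set M) (a : R) :
  set M := [set x | K (a *: x)].

(** Trades the finitely supported sum for an ordinary big sum, to which
    scalars distribute and over which induction is possible.  The vanishing
    off [r] is recorded so that a family obtained by scaling [f], whose support
    may shrink, can be summed over the same [r]. *)
Lemma decomposition_sumE (V : zmodType) (G : choiceType) (A : G -> set V)
    (v : V) (f : G -> V) :
  decomposition A v f ->
  exists r : {fset G}, (forall g, g \notin r -> f g = 0) /\
    v = \sum_(g <- r) f g.
Proof.
move=> [_ fin ->]; exists (fset_set [set g | f g != 0]); split.
  by move=> g; rewrite in_fset_set// notin_setE => /negP/negPn/eqP.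
apply: fsbigTE => g; rewrite in_fset_set// notin_setE.
by move=> /negP/negPn/eqP.
Qed.

Lemma decompositionS (V : zmodType) (G : choiceType) (A B : G -> set V)
    (v : V) (f : G -> V) :
  (forall g, B g (f g)) -> decomposition A v f -> decomposition B v f.
Proof. by move=> Bf []. Qed.

(** Multiplying by an element of degree [h] moves degree [h^-1 g] to degree
    [g], and left multiplication by [h] is a bijection of [G] along which the
    sum can be reindexed. *)
Lemma decomposition_scale (G : groupType) (R : comNzRingType) (Rg : G -> set R)
    (M : lmodType R) (Mg : G -> set M) (hM : graded_module Rg Mg)
    (h : G) (a : R) (v : M) (f : G -> M) :
  Rg h a -> decomposition Mg v f ->
  decomposition Mg (a *: v) (fun g => a *: f (h^-1 * g)%g).
Proof.
move=> ah df; have [Mf fin _] := df.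
have [r [f0 ->]] := decomposition_sumE df.
split.
- move=> g; have := hM.2 _ _ _ _ ah (Mf (h^-1 * g)%g).
  by rewrite mulgA mulgV mul1g.
- apply: (sub_finite_set _ (finite_image (fun g => h * g)%g fin)) => g /= ag0.
  exists (h^-1 * g)%g; last by rewrite mulgA mulgV mul1g.
  by apply: contraNneq ag0 => ->; rewrite scaler0.
- rewrite (reindex_fsbigT (fun g => h * g)%g); last first.
    by exists (fun g => h^-1 * g)%g => g; rewrite mulgA ?mulgV ?mulVg mul1g.
  rewrite (fsbigTE r) => [|g /f0 fg0]; last by rewrite mulgA mulVg mul1g fg0 scaler0.
  by rewrite scaler_sumr; apply: eq_bigr => g _; rewrite mulgA mulVg mul1g.
Qed.

(** Inside a graded module a submodule is graded exactly when it contains the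
    homogeneous components of its elements: existence and uniqueness of the
    components are inherited from the ambient module. *)
Lemma graded_submoduleP (G : groupType) (R : comNzRingType) (M : lmodType R)
    (Mg : G -> set M) (K : set M) :
  is_direct_sum [set: M] Mg ->
  graded_submodule Mg K <->
    submod_closed [in K] /\
    forall v f, K v -> decomposition Mg v f -> forall g, K (f g).
Proof.
move=> [Mz ME Muniq]; split=> [[Ksub [_ KE _]]|[Ksub Kcomp]]; split=> //.
  move=> v f; rewrite {1}KE => -[f' df'] df g.
  have dMf' : decomposition Mg v f'.
    by apply: decompositionS (df') => g'; have [/(_ g')[]] := df'.
  by rewrite (Muniq _ _ _ df dMf'); have [/(_ g)[]] := df'.
have [K0 KD] := Ksub; split.
- move=> g; have [M0 MB] := Mz g; split.
    by rewrite inE; split; apply: set_mem.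
  move=> x y /set_mem[Kx Mx] /set_mem[Ky My].
  apply/mem_set; split; last by apply/set_mem/MB; apply/mem_set.
  by rewrite -scaleN1r addrC; apply/set_mem/KD; apply/mem_set.
- apply/seteqP; split=> v /= => [Kv|[f df]].
    have [f df] : [set v | exists f, decomposition Mg v f] v by rewrite -ME.
    exists f; apply: decompositionS (df) => g.
    by split; [exact: Kcomp df g|have [] := df].
  have [Kf _ _] := df; have [r [_ ->]] := decomposition_sumE df.
  apply: (big_ind K); first exact: set_mem.
    by move=> x y Kx Ky; rewrite -[x]scale1r; apply/set_mem/KD; apply/mem_set.
  by move=> g _; have [] := Kf g.
- move=> v f f' df df'; apply: (Muniq v).
    by apply: decompositionS (df) => g; have [/(_ g)[]] := df.
  by apply: decompositionS (df') => g; have [/(_ g)[]] := df'.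
Qed.

Lemma submod_closed_residual (R : comNzRingType) (M : lmodType R) (K : set M)
    (a : R) :
  submod_closed [in K] -> submod_closed [in residual K a].
Proof.
move=> [K0 KD]; split; first by rewrite inE /residual /= scaler0 -in_setE.
move=> c x y /set_mem Kx /set_mem Ky; apply/mem_set; rewrite /residual /=.
rewrite scalerDr scalerA mulrC -scalerA.
by apply/set_mem/KD; apply/mem_set.
Qed.

Lemma subset_residual (R : comNzRingType) (M : lmodType R) (K : set M) (a : R) :
  submod_closed [in K] -> K `<=` residual K a.
Proof.
move=> [K0 KD] x Kx; rewrite /residual /= -[_ *: _]addr0.
by apply/set_mem/KD => //; apply/mem_set.
Qed.

Lemma graded_residual (G : groupType) (R : comNzRingType) (Rg : G -> set R)
    (M : lmodType R) (Mg : G -> set M) (hM : graded_module Rg Mg)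
    (K : set M) (a : R) :
  homogeneous Rg a -> graded_submodule Mg K ->
  graded_submodule Mg (residual K a).
Proof.
move=> [h _ ah] /(graded_submoduleP _ hM.1)[Ksub Kcomp].
apply/(graded_submoduleP _ hM.1).
split; first exact: submod_closed_residual.
move=> v f Kav df g; rewrite /residual /=.
(* The component of [a *: v] in degree [h g] is [a *: f g]. *)
have := Kcomp _ _ Kav (decomposition_scale hM ah df) (h * g)%g.
by rewrite mulgA mulVg mul1g.
Qed.

(** The product [a b] is homogeneous, so specialness of [K] applies to it. *)
Lemma graded_special_residual (G : groupType) (R : comNzRingType)
    (Rg : G -> set R) (hR : graded_ring Rg) (M : lmodType R) (Mg : G -> set M)
    (hM : graded_module Rg Mg) (K : set M) (a : R) :
  homogeneous Rg a -> ~ colon K a -> graded_special_r Rg Mg K ->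
  graded_special_r Rg Mg (residual K a).
Proof.
move=> ah Ka [Kgr _ Kspec]; split; first exact: (graded_residual hM ah Kgr).
  move=> LT; apply: Ka => m.
  by have : [set: M] m by []; rewrite -LT.
move=> b y [k _ bk] yh Kby Ay m; have [h _ ha] := ah.
rewrite /residual /= scalerA; apply: (Kspec _ y) => //; last first.
  by rewrite -scalerA.
by exists (h * k)%g => //; exact: hR.2.
Qed.

Theorem theorem4p23 (G : groupType) (R : comNzRingType) (Rg : G -> set R)
    (hR : graded_ring Rg) (M : lmodType R) (Mg : G -> set M)
    (hM : graded_module Rg Mg) (hM0 : exists m : M, m != 0)
    (K : set M) (hK : graded_maximal_special_r Rg Mg K) :
  graded_prime Rg Mg K.
Proof.
have [Kspec Kmax] := hK; have [Kgr Kproper _] := Kspec.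
split=> // a x ah _ Kax.
have [Ka|Ka] := pselect (colon K a); [by right|left].
rewrite -(Kmax (residual K a)) //; last exact: (subset_residual _ Kgr.1).
exact: graded_special_residual.
Qed.
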